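(* Let $(X,d)$ be a nonempty compact metric space, and let $\mathcal{F}$ be the family of all $d$-contractive self-maps of $X$. Then $\mathcal{F}$ has a common extension defined on $2^{\mathbb{N}}$; that is, there exists a continuous map $U:2^{\mathbb{N}}\to 2^{\mathbb{N}}$ such that every $T\in\mathcal{F}$ is a factor of $U$.
   Context: A self-map $T:X\to X$ is $d$-contractive if there is $c\in(0,1)$ such that $d(T(x),T(y))\le c\,d(x,y)$ for all $x,y\in X$. $2^{\mathbb{N}}$ is the Cantor space. A continuous self-map $T:X\to X$ is a factor of a continuous self-map $S:E\to E$ if there is a continuous map $\pi$ from $E$ onto $X$ with $T\pi=\pi S$. *)

(* Defs.v *)
From HB Require Import structures.
From mathcomp Require Import all_boot all_order all_algebra.
From mathcomp Require Import all_classical all_reals all_analysis.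

Set Implicit Arguments.
Unset Strict Implicit.
Unset Printing Implicit Defensive.

Import Order.TTheory GRing.Theory Num.Theory.

Local Open Scope classical_set_scope.
Local Open Scope ring_scope.

(* The library's [contraction] is restricted to normed modules, hence this
   version for metric spaces. *)
Definition contractive (R : realType) (X : metricType R) (T : X -> X) : Prop :=
  exists2 c : R, 0 < c < 1 & forall x y, mdist (T x) (T y) <= c * mdist x y.

Definition is_factor (X E : topologicalType) (T : X -> X) (S : E -> E) : Prop :=
  [/\ continuous T, continuous S &
      exists pi : E -> X,
        [/\ continuous pi, set_surj [set: E] [set: X] pi & T \o pi = pi \o S]].

(* Main.v *)
Require Import Defs.
From HB Require Import structures.
From mathcomp Require Import all_boot all_order all_algebra.
From mathcomp Require Import all_classical all_reals all_analysis.
From mathcomp Require Import lra.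

Set Implicit Arguments.
Unset Strict Implicit.
Unset Printing Implicit Defensive.

Import Order.TTheory GRing.Theory Num.Theory.
Import numFieldTopology.Exports.
Import metricType_numDomainType.

Local Open Scope classical_set_scope.
Local Open Scope ring_scope.

(** The map [U] inserts a leading [true] in a binary sequence.  The sequences
    with finitely many leading [true]s, [true^n false w], form a copy of
    [nat * 2^N] on which [U] acts by [(n, w) |-> (n.+1, w)], and the constant
    sequence [true] is the point at infinity, fixed by [U].  So [U] is the
    one-point compactification of a free forward orbit started at a Cantor
    set.

    Given a continuous surjection [p] from the Cantor space to [X]
    (Alexandroff-Hausdorff), an equivariant map to [(X, T)] is determined on
    these orbits by its values [p w] at [(0, w)]: it sends [(n, w)] to
    [T^n (p w)].  It is already onto on the sequences that start with [false].
    The one constraint is continuity at infinity, where the value is the fixed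
    point [a] of [T]: it holds because [T^n] converges to [a] uniformly, as
    [mdist a (T^n y) <= c^n * diam X].  Nothing in [U] depends on [T], not even
    on its contraction constant. *)

(** * Contractive maps of a compact metric space *)

Lemma mlipschitz_continuous (R : realType) (X Y : metricType R) (f : X -> Y)
    (k : R) :
  (forall x y, mdist (f x) (f y) <= k * mdist x y) -> continuous f.
Proof.
move=> fk x; apply/cvgrPdist_lt => e e0.
have k0 : 0 < `|k| + 1 by rewrite ltr_wpDl.
have xk : \forall y \near x, mdist x y < e / (`|k| + 1).
  by apply: cvgr_dist_lt; [exact: cvg_id | rewrite divr_gt0].
apply: filterS xk => y; rewrite ltr_pdivlMr// => xy.
rewrite (le_lt_trans _ xy)// (le_trans (fk x y))// mulrC ler_wpM2l ?mdist_ge0//.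
by rewrite (le_trans (ler_norm k))// lerDl.
Qed.

Lemma contractive_continuous (R : realType) (X : metricType R) (T : X -> X) :
  contractive T -> continuous T.
Proof. by case=> c _ Tc; exact: mlipschitz_continuous Tc. Qed.

Lemma mdist_continuous (R : realType) (X : metricType R) (a : X) :
  continuous (mdist a : X -> R).
Proof.
apply: (@mlipschitz_continuous R X R^o _ 1) => x y; rewrite mul1r.
rewrite [leLHS]/(`|_ - _|) ler_norml.
have := metric_triangle a x y; have := metric_triangle a y x.
by rewrite (metric_sym y x); lra.
Qed.

Lemma contractive_displacement_continuous (R : realType) (X : metricType R)
    (T : X -> X) :
  contractive T -> continuous (fun x => mdist x (T x) : R).
Proof.
case=> c /andP[c0 c1] Tc.
apply: (@mlipschitz_continuous R X R^o _ 2) => x y.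
rewrite [leLHS]/(`|_ - _|) ler_norml.
have Txy : mdist (T x) (T y) <= mdist x y.
  by rewrite (le_trans (Tc x y))// ler_piMl ?mdist_ge0// ltW.
have := metric_triangle x y (T x); have := metric_triangle y (T y) (T x).
have := metric_triangle y x (T y); have := metric_triangle x (T x) (T y).
by rewrite (metric_sym y x) (metric_sym (T y) (T x)); lra.
Qed.

(** A point [a] that minimizes [mdist a (T a)] is fixed, since [T] would
    otherwise send it to a point of smaller displacement. *)
Lemma contractive_fixpoint (R : realType) (X : metricType R) (T : X -> X) :
  [set: X] !=set0 -> compact [set: X] -> contractive T -> exists a, T a = a.
Proof.
move=> X0 cX cT; have := contractive_displacement_continuous cT.
move=> /(@continuous_subspaceT _ _ setT) /(compact_EVT_min X0 cX)[a _ amin].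
exists a; apply/esym/mdist_positivity/eqP.
case: cT => c /andP[c0 c1] Tc.
have := le_trans (amin (T a) (in_setT _)) (Tc a (T a)).
rewrite eq_le mdist_ge0 andbT => ca; rewrite leNgt; apply/negP => d0.
by move: ca; rewrite leNgt gtr_pMl// c1.
Qed.

Lemma compact_mdist_bounded (R : realType) (X : metricType R) (a : X) :
  compact [set: X] -> exists D : R, forall x, mdist a x <= D.
Proof.
move=> cX; have X0 : [set: X] !=set0 by exists a.
have := @mdist_continuous R X a.
move=> /(@continuous_subspaceT _ _ setT) /(compact_EVT_max X0 cX)[b _ bmax].
by exists (mdist a b) => x; exact/bmax/in_setT.
Qed.

(** [mdist a (T^n y) <= D * c^n] where [D] bounds the distance to [a]; compactness
    of [X] gives such a [D], and with it a rank [N] uniform in [y]. *)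
Lemma contractive_iter_uniform_cvg (R : realType) (X : metricType R)
    (T : X -> X) (a : X) :
  compact [set: X] -> contractive T -> T a = a ->
  forall e : R, 0 < e ->
  exists N, forall n y, (N <= n)%N -> mdist a (iter n T y) < e.
Proof.
move=> cX [c /andP[c0 c1] Tc] Ta e e0.
have [D aD] := compact_mdist_bounded a cX.
have aiter n y : mdist a (iter n T y) <= D * c ^+ n.
  elim: n => [|n IHn]; first by rewrite expr0 mulr1.
  rewrite -{1}Ta iterS (le_trans (Tc _ _))// exprS mulrCA.
  by rewrite ler_wpM2l// ltW.
have /cvgr0_norm_lt/(_ e e0)[N _ De] : geometric D c @ \oo --> (0 : R).
  by apply: cvg_geometric; rewrite gtr0_norm.
exists N => n y Nn; rewrite (le_lt_trans (aiter n y))//.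
by rewrite (le_lt_trans (ler_norm _))//; exact: De.
Qed.

(** * Binary sequences *)

Definition cantor_cons (b : bool) (z : cantor_space) : cantor_space :=
  fun i => if i is j.+1 then z j else b.

Definition cantor_drop (n : nat) (z : cantor_space) : cantor_space :=
  fun i => z (n + i)%N.

Lemma cantor_coord_continuous (i : nat) :
  continuous (fun z : cantor_space => z i).
Proof. exact: (@proj_continuous nat (fun=> bool) i). Qed.

Lemma continuous_to_cantor (E : topologicalType) (f : E -> cantor_space) :
  (forall i, continuous (fun x => f x i)) -> continuous f.
Proof.
move=> fi x; apply/cvg_sup => i.
move=> A [_ [[B Bop <-] Bfx sBA]]; apply: filterS sBA _.
apply: (fi i x); exact: open_nbhs_nbhs.
Qed.

Lemma cantor_prefix_near (n : nat) (z : cantor_space) :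
  \forall y \near z, forall i, (i < n)%N -> y i = z i.
Proof.
elim: n => [|n IHn]; first by near=> y => i; rewrite ltn0.
have zn : \forall y \near z, y n = z n.
  apply: (@cantor_coord_continuous n z [set z n]).
  by apply: open_nbhs_nbhs; split=> //; exact: discrete_open.
apply: filterS2 zn IHn => y yn yi i.
by rewrite ltnS leq_eqVlt => /predU1P[->|/yi].
Unshelve. all: by end_near. Qed.

Lemma cantor_cons_continuous (b : bool) : continuous (cantor_cons b).
Proof.
apply: continuous_to_cantor => -[|i]; first exact: cst_continuous.
exact: cantor_coord_continuous.
Qed.

Lemma cantor_drop_continuous (n : nat) : continuous (cantor_drop n).
Proof. by apply: continuous_to_cantor => i; exact: cantor_coord_continuous. Qed.

(** * The factor map *)

(** The point [(n, w)] is encoded by [true^n false w]: [n] is the rank of the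
    first [false] and [w] is what remains after dropping [n.+1] terms.  The
    [else] branch is the point at infinity. *)
Definition orbit_map (X : Type) (T : X -> X) (a : X) (p : cantor_space -> X)
    (z : cantor_space) : X :=
  if pselect (exists n, ~~ z n) is left h then
    iter (ex_minn h) T (p (cantor_drop (ex_minn h).+1 z))
  else a.

Section orbit_map_theory.
Context (X : Type) (T : X -> X) (a : X) (p : cantor_space -> X).

Lemma orbit_map_finite (n : nat) (z : cantor_space) :
  (forall i, (i < n)%N -> z i) -> ~~ z n ->
  orbit_map T a p z = iter n T (p (cantor_drop n.+1 z)).
Proof.
move=> zn zNn; rewrite /orbit_map; case: pselect => [h|[]]; last by exists n.
case: ex_minnP => m zNm /(_ n zNn) mn.
suff -> : m = n by [].
by apply/eqP; rewrite eqn_leq mn leqNgt; apply: contra zNm => /zn.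
Qed.

Lemma orbit_map_infty (z : cantor_space) :
  (forall i, z i) -> orbit_map T a p z = a.
Proof.
move=> zT; rewrite /orbit_map; case: pselect => [h|//].
by have [n] := h; rewrite zT.
Qed.

Lemma cantor_leading_trues (z : cantor_space) :
  (forall i, z i) \/ exists2 n, (forall i, (i < n)%N -> z i) & ~~ z n.
Proof.
have [h|/forallNP zT] := pselect (exists n, ~~ z n); last first.
  by left=> i; exact/negPn/negP/zT.
right; case: (ex_minnP h) => n zn nmin; exists n => // i.
by rewrite ltnNge; apply: contraR => /nmin.
Qed.

Lemma orbit_map_false (w : cantor_space) :
  orbit_map T a p (cantor_cons false w) = p w.
Proof. exact: (@orbit_map_finite 0). Qed.

Lemma orbit_map_true (z : cantor_space) : T a = a ->
  orbit_map T a p (cantor_cons true z) = T (orbit_map T a p z).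
Proof.
move=> Ta; have [zT|[n zn zNn]] := cantor_leading_trues z.
  by rewrite !orbit_map_infty// => -[].
rewrite (orbit_map_finite zn zNn) -iterS.
by rewrite (@orbit_map_finite n.+1)// => -[|i]//; exact: zn.
Qed.

End orbit_map_theory.

Lemma continuous_iter (X : topologicalType) (T : X -> X) (n : nat) :
  continuous T -> continuous (iter n T).
Proof.
move=> cT; elim: n => [x|n IHn x]; first exact: cvg_id.
by apply: (@continuous_comp _ _ _ (iter n T) T); [exact: IHn | exact: cT].
Qed.

(** Near a sequence with finitely many leading [true]s this number is constant;
    near infinity it is large, so uniform convergence of the iterates applies. *)
Lemma orbit_map_continuous (R : realType) (X : metricType R) (T : X -> X)
    (a : X) (p : cantor_space -> X) :
  continuous T -> continuous p ->
  (forall e : R, 0 < e ->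
    exists N, forall n y, (N <= n)%N -> mdist a (iter n T y) < e) ->
  continuous (orbit_map T a p).
Proof.
move=> cT cp unif z; have [zT|[n zn zNn]] := cantor_leading_trues z.
  apply/cvgrPdist_lt => e e0; rewrite orbit_map_infty//.
  have [N aN] := unif e e0.
  apply: filterS (cantor_prefix_near N z) => y yN.
  have [yT|[n yn yNn]] := cantor_leading_trues y.
    by rewrite orbit_map_infty// mdistxx.
  rewrite (orbit_map_finite _ _ _ yn yNn); apply: aN.
  by rewrite leqNgt; apply: contra yNn => /yN ->; exact: zT.
pose g y := iter n T (p (cantor_drop n.+1 y)).
have gE : \forall y \near z, g y = orbit_map T a p y.
  apply: filterS (cantor_prefix_near n.+1 z) => y yn.
  rewrite (@orbit_map_finite _ _ _ _ n)//; last by rewrite yn.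
  by move=> i ni; rewrite yn ?zn// ltnW.
rewrite /continuous_at -(nbhs_singleton gE).
apply: cvg_trans; first exact: near_eq_cvg gE.
apply: (@continuous_comp _ _ _ (p \o cantor_drop n.+1) (iter n T)).
  by apply: continuous_comp; [exact: cantor_drop_continuous | exact: cp].
exact: continuous_iter.
Qed.

(** The Alexandroff-Hausdorff theorem for a nonempty space without a
    distinguished point. *)
Lemma metric_cantor_surj (R : realType) (X : metricType R) :
  [set: X] !=set0 -> compact [set: X] ->
  exists2 p : cantor_space -> X,
    continuous p & set_surj [set: cantor_space] [set: X] p.
Proof.
move=> [x0 _] cX.
pose pX : pseudoPMetricType R :=
  HB.pack (X : Type) (Metric.on X) (isPointed.Build X x0).
have [p cp] := @cantor_surj R pX cX (@metric_hausdorff R X).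
by exists p => //; exact: surj.
Qed.

Theorem corollary4p16 (R : realType) (X : metricType R)
    (X_nonempty : [set: X] !=set0) (X_compact : compact [set: X]) :
  exists U : cantor_space -> cantor_space,
    continuous U /\ forall T : X -> X, contractive T -> is_factor T U.
Proof.
have [p cp surjp] := metric_cantor_surj X_nonempty X_compact.
exists (cantor_cons true); split=> [|T contrT].
  exact: cantor_cons_continuous.
have [a Ta] := contractive_fixpoint X_nonempty X_compact contrT.
have cT := contractive_continuous contrT.
split=> //; first exact: cantor_cons_continuous.
exists (orbit_map T a p); split.
- apply: orbit_map_continuous => // e.
  exact: contractive_iter_uniform_cvg.
- move=> x /surjp[w _ <-]; exists (cantor_cons false w) => //.
  exact: orbit_map_false.
- by apply/funext => z /=; rewrite orbit_map_true.
Qed.
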